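(* Let $X,Y$ be two connected locally finite graphs that are proper homotopy equivalent. Then $\mathrm{Maps}(X)$ and $\mathrm{Maps}(Y)$ are isomorphic as topological groups.
   Context: A map $f:X\to Y$ is a proper homotopy equivalence if it is proper and there is a proper map $g:Y\to X$ such that $fg$ and $gf$ are both properly homotopic to the identity. $\mathrm{Maps}(X)$ is the group of proper homotopy equivalences $X\to X$ up to proper homotopy. Topology on $\mathrm{Maps}(X)$: let $\hat X=X\sqcup\partial X$ be the Freudenthal (end) compactification, where $\partial X=\varprojlim_{K}\pi_0(X\smallsetminus K)$ over compact $K\subset X$. Proper maps $f:X\to X$ extend to continuous maps $\hat f:\hat X\to\hat X$. Let $(\hat X\to\hat X)$ be the space of continuous maps with the compact-open topology, and let $PH(X)\subset(\hat X\to\hat X)^2$ be the subspace of pairs $(\hat f,\hat g)$ that are extensions of proper homotopy equivalences $f,g:X\to X$ which are proper homotopy inverses of each other. $\mathrm{Maps}(X)$ has the quotient topology from the surjection $PH(X)\to \mathrm{Maps}(X)$, $(\hat f,\hat g)\mapsto [f]$. *)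

(* Defs.v *)
From HB Require Import structures.
From mathcomp Require Import all_boot all_order all_algebra.
From mathcomp Require Import all_classical all_reals.
From mathcomp Require Import topology normedtype homotopy.
From mathcomp Require Import ring lra.

Set Implicit Arguments.
Unset Strict Implicit.
Unset Printing Implicit Defensive.

Import Order.TTheory GRing.Theory Num.Theory.
Import numFieldNormedType.Exports.

Local Open Scope classical_set_scope.
Local Open Scope ring_scope.
Local Open Scope quotient_scope.

Definition unit_interval (R : realType) : Type := `[0%R, 1%R : R]%classic.
HB.instance Definition _ (R : realType) :=
  Topological.copy (unit_interval R) (`[0%R, 1%R : R]%classic : Type).

Section unit_interval.
Context {R : realType}.
Local Notation I := (unit_interval R).
Implicit Types t : I.

Definition ival (t : I) : R := set_val t.

Lemma ival_itv t : 0 <= ival t <= 1.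
Proof. by have := set_mem (svalP t); rewrite /= in_itv. Qed.

Lemma ival_ge0 t : 0 <= ival t. Proof. by case/andP: (ival_itv t). Qed.
Lemma ival_le1 t : ival t <= 1. Proof. by case/andP: (ival_itv t). Qed.

Lemma ival_inj : injective ival.
Proof. by move=> s t; exact: val_inj. Qed.

Lemma ival_continuous : continuous ival.
Proof. exact: initial_continuous. Qed.

Lemma clamp_subproof (r : R) : Num.max 0 (Num.min 1 r) \in `[0%R, 1%R]%classic.
Proof.
by rewrite inE/= in_itv/= le_max lexx/= ge_max ler01/= ge_min lexx.
Qed.

Definition clamp (r : R) : I :=
  exist (fun x : R => x \in `[0%R, 1%R]%classic) _ (clamp_subproof r).

Lemma clampE r : 0 <= r <= 1 -> ival (clamp r) = r.
Proof.
move=> /andP[r0 r1]; rewrite /ival /clamp set_valE/=.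
by rewrite (min_idPr r1) (max_idPr r0).
Qed.

Lemma ivalK : cancel ival clamp.
Proof. by move=> t; apply: ival_inj; rewrite clampE// ival_itv. Qed.

Lemma clamp_continuous : continuous clamp.
Proof.
apply: continuous_comp_initial => r /=.
apply: (@continuous_max _ _ (cst 0) (fun r : R => Num.min 1 r)).
  exact: cst_continuous.
apply: (@continuous_min _ _ (cst 1) id); first exact: cst_continuous.
exact: cvg_id.
Qed.

Lemma ival0 : ival (clamp 0) = 0. Proof. by rewrite clampE// lexx ler01. Qed.
Lemma ival1 : ival (clamp 1) = 1. Proof. by rewrite clampE// lexx ler01. Qed.

Lemma clamp01 : clamp 0 != clamp 1.
Proof.
by apply/eqP => /(congr1 ival); rewrite ival0 ival1 => /eqP; rewrite eq_sym oner_eq0.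
Qed.

HB.instance Definition _ := isBiPointed.Build I clamp01.

Lemma ival_zero : ival (zero : I) = 0. Proof. exact: ival0. Qed.
Lemma ival_one : ival (one : I) = 1. Proof. exact: ival1. Qed.

Lemma unit_interval_compact : compact [set: I].
Proof.
have -> : [set: I] = clamp @` `[0%R, 1%R]%classic.
  apply/seteqP; split => // t _; exists (ival t); last exact: ivalK.
  by rewrite /= in_itv/= ival_itv.
apply: continuous_compact; last exact: segment_compact.
by apply: continuous_subspaceT; exact: clamp_continuous.
Qed.

End unit_interval.

Definition proper_map (X Y : topologicalType) (f : X -> Y) : Prop :=
  continuous f /\ forall K : set Y, compact K -> compact (f @^-1` K).

Definition proper_homotopic (R : realType) (X Y : topologicalType)
    (f g : X -> Y) : Prop :=
  exists H : X * unit_interval R -> Y,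
    [/\ proper_map H, forall x, H (x, zero) = f x & forall x, H (x, one) = g x].

Definition proper_homotopy_inverse (R : realType) (X Y : topologicalType)
    (f : X -> Y) (g : Y -> X) : Prop :=
  [/\ proper_map f, proper_map g,
      proper_homotopic R (f \o g) id & proper_homotopic R (g \o f) id].

Definition proper_homotopy_equivalence (R : realType) (X Y : topologicalType)
    (f : X -> Y) : Prop :=
  exists g : Y -> X, proper_homotopy_inverse R f g.

Definition proper_homotopy_equivalent (R : realType) (X Y : topologicalType)
    : Prop :=
  exists f : X -> Y, proper_homotopy_equivalence R f.

Lemma pair_continuous (X Y Z : topologicalType) (f : X -> Y) (g : X -> Z) :
  continuous f -> continuous g -> continuous (fun x => (f x, g x)).
Proof. by move=> cf cg x; apply: cvg_pair => //; [exact: cf|exact: cg]. Qed.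

Lemma comp_continuous (X Y Z : topologicalType) (f : X -> Y) (g : Y -> Z) :
  continuous f -> continuous g -> continuous (g \o f).
Proof. by move=> cf cg x; apply: continuous_comp; [exact: cf|exact: cg]. Qed.

Lemma fst_continuous (X Y : topologicalType) : continuous (@fst X Y).
Proof. by move=> x; exact: cvg_fst. Qed.

Lemma snd_continuous (X Y : topologicalType) : continuous (@snd X Y).
Proof. by move=> x; exact: cvg_snd. Qed.

Lemma image_compact (X Y : topologicalType) (f : X -> Y) (K : set X) :
  continuous f -> compact K -> compact (f @` K).
Proof.
by move=> cf cK; apply: continuous_compact => //; exact: continuous_subspaceT.
Qed.

Section concat.
Context {R : realType} {X Y : topologicalType}.
Local Notation I := (unit_interval R).
Implicit Types (H K : X * I -> Y) (p : X * I).

Definition concat H K p : Y :=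
  if ival p.2 <= 2^-1 then H (p.1, clamp (2 * ival p.2))
  else K (p.1, clamp (2 * ival p.2 - 1)).

Let snd_ival_continuous : continuous (fun p : X * I => ival p.2).
Proof.
by apply: (@comp_continuous _ _ _ snd ival);
  [exact: snd_continuous|exact: ival_continuous].
Qed.

Lemma reparam_continuous (g : R -> R) : continuous g ->
  continuous (fun p : X * I => (p.1, clamp (g (ival p.2)) : I)).
Proof.
move=> cg; apply: pair_continuous; first exact: fst_continuous.
apply: (@comp_continuous _ _ _ (fun p : X * I => g (ival p.2)) clamp).
  apply: (@comp_continuous _ _ _ (fun p : X * I => ival p.2) g) => //.
exact: clamp_continuous.
Qed.

Let dbl_continuous : continuous (fun r : R => 2 * r).
Proof. by move=> r; apply: cvgM; [exact: cvg_cst|exact: cvg_id]. Qed.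

Let dbl1_continuous : continuous (fun r : R => 2 * r - 1).
Proof. by move=> r; apply: cvgB; [exact: dbl_continuous|exact: cvg_cst]. Qed.

Lemma concat_continuous H K : continuous H -> continuous K ->
  (forall x, H (x, one) = K (x, zero)) -> continuous (concat H K).
Proof.
move=> cH cK HK; apply/continuous_subspace_setT.
pose A := [set p : X * I | ival p.2 <= 2^-1].
pose B := [set p : X * I | 2^-1 <= ival p.2].
have -> : setT = A `|` B.
  apply/seteqP; split => // p _; have [|/ltW] := leP (ival p.2) 2^-1.
  - by left.
  - by right.
have cA : closed A.
  apply: (@closed_comp _ _ (fun p : X * I => ival p.2) [set r : R | r <= 2^-1]).
    by move=> p _; exact: snd_ival_continuous.
  exact: closed_le.
have cB : closed B.
  apply: (@closed_comp _ _ (fun p : X * I => ival p.2) [set r : R | 2^-1 <= r]).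
    by move=> p _; exact: snd_ival_continuous.
  exact: closed_ge.
apply: withinU_continuous => //.
- apply: (@subspace_eq_continuous _ _ _
    (fun p => H (p.1, clamp (2 * ival p.2)))).
    by move=> p /set_mem pA; rewrite /from_subspace /concat ifT.
  apply: continuous_subspaceT.
  apply: (@comp_continuous _ _ _ (fun p => (p.1, clamp (2 * ival p.2))) H) => //.
  exact: reparam_continuous.
- apply: (@subspace_eq_continuous _ _ _
    (fun p => K (p.1, clamp (2 * ival p.2 - 1)))).
    move=> p /set_mem pB; rewrite /from_subspace /concat /=; case: ifPn => // pA.
    have -> : ival p.2 = 2^-1 by apply/eqP; rewrite eq_le pA.
    by rewrite divff ?pnatr_eq0// subrr -[clamp 1]/one -[clamp 0]/zero HK.
  apply: continuous_subspaceT.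
  apply: (@comp_continuous _ _ _
    (fun p => (p.1, clamp (2 * ival p.2 - 1))) K) => //.
  exact: (@reparam_continuous (fun r => 2 * r - 1)).
Qed.

Lemma concat_zero H K x : concat H K (x, zero) = H (x, zero).
Proof.
rewrite /concat/= ival_zero invr_ge0 ler0n mulr0.
by rewrite -ival_zero ivalK.
Qed.

Lemma concat_one H K x : concat H K (x, one) = K (x, one).
Proof.
rewrite /concat/= ival_one ifF; last by lra.
by rewrite mulr1 (_ : 2 - 1 = ival one) ?ivalK// ival_one; ring.
Qed.

Lemma concat_proper H K : proper_map H -> proper_map K ->
  (forall x, H (x, one) = K (x, zero)) -> proper_map (concat H K).
Proof.
move=> [cH pH] [cK pK] HK; split; first exact: concat_continuous.
move=> C cC.
pose f1 (p : X * I) : X * I := (p.1, clamp (ival p.2 / 2)).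
pose f2 (p : X * I) : X * I := (p.1, clamp ((ival p.2 + 1) / 2)).
have -> : concat H K @^-1` C = f1 @` (H @^-1` C) `|` f2 @` (K @^-1` C).
  apply/seteqP; split => [[x t]|].
    have /andP[t0 t1] := ival_itv t.
    rewrite /= /concat/=; case: ifPn => [t2 Ct|]; [left|rewrite -ltNge; right].
      exists (x, clamp (2 * ival t)) => //.
      rewrite /f1/= clampE; last by lra.
      by rewrite [2 * _]mulrC mulfK ?pnatr_eq0// ivalK.
    exists (x, clamp (2 * ival t - 1)) => //.
    rewrite /f2/= clampE; last by lra.
    by rewrite subrK [2 * _]mulrC mulfK ?pnatr_eq0// ivalK.
  move=> _ [] [[x t] Ct <-] /=; have /andP[t0 t1] := ival_itv t.
    rewrite /concat/= clampE; last by lra.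
    rewrite ifT; last by lra.
    by rewrite mulrCA divff ?pnatr_eq0// mulr1 ivalK.
  rewrite /concat/= clampE; last by lra.
  case: ifPn => t2.
    have t0' : ival t = 0 by lra.
    rewrite t0' add0r mul1r divff ?pnatr_eq0// -[clamp 1]/one HK.
    by rewrite (_ : zero = t)//; apply: ival_inj; rewrite ival_zero.
  by rewrite mulrCA divff ?pnatr_eq0// mulr1 addrK ivalK.
apply: compactU; apply: image_compact; try exact: pH; try exact: pK.
  apply: (@reparam_continuous (fun r => r / 2)).
  by move=> r; apply: cvgM; [exact: cvg_id|exact: cvg_cst].
apply: (@reparam_continuous (fun r => (r + 1) / 2)).
move=> r; apply: cvgM; last exact: cvg_cst.
by apply: cvgD; [exact: cvg_id|exact: cvg_cst].
Qed.

Definition reverse H p : Y := H (p.1, clamp (1 - ival p.2)).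

Let sub1_continuous : continuous (fun r : R => 1 - r).
Proof. by move=> r; apply: cvgB; [exact: cvg_cst|exact: cvg_id]. Qed.

Lemma reverse_continuous H : continuous H -> continuous (reverse H).
Proof.
move=> cH.
apply: (@comp_continuous _ _ _ (fun p => (p.1, clamp (1 - ival p.2))) H) => //.
exact: (@reparam_continuous (fun r => 1 - r)).
Qed.

Lemma reverse_zero H x : reverse H (x, zero) = H (x, one).
Proof. by rewrite /reverse/= ival_zero subr0. Qed.

Lemma reverse_one H x : reverse H (x, one) = H (x, zero).
Proof. by rewrite /reverse/= ival_one subrr. Qed.

Lemma reverse_proper H : proper_map H -> proper_map (reverse H).
Proof.
move=> [cH pH]; split; first exact: reverse_continuous.
move=> C /pH cC.
pose f (p : X * I) : X * I := (p.1, clamp (1 - ival p.2)).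
have fK : involutive f.
  move=> [x t]; have /andP[t0 t1] := ival_itv t.
  rewrite /f/= clampE; last by lra.
  by rewrite opprB addrC subrK ivalK.
have -> : reverse H @^-1` C = f @` (H @^-1` C).
  apply/seteqP; split => [p Cp|_ [p Cp <-]]; first by exists (f p); rewrite ?fK.
  by rewrite /= -[reverse H _]/(H (f (f p))) fK.
apply: image_compact => //.
exact: (@reparam_continuous (fun r => 1 - r)).
Qed.

End concat.

Section proper.
Context {R : realType}.
Implicit Types X Y Z : topologicalType.
Local Notation I := (unit_interval R).

Lemma proper_id X : proper_map (@id X).
Proof. by split => // x; exact: cvg_id. Qed.

Lemma proper_comp X Y Z (f : X -> Y) (g : Y -> Z) :
  proper_map f -> proper_map g -> proper_map (g \o f).
Proof.
move=> [cf pf] [cg pg]; split; first exact: comp_continuous.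
by move=> K /pg/pf.
Qed.

Lemma proper_homotopic_refl X Y (f : X -> Y) :
  proper_map f -> proper_homotopic R f f.
Proof.
move=> [cf pf]; exists (f \o fst); split => //; split.
  by apply: comp_continuous => //; exact: fst_continuous.
move=> K /pf cK; rewrite (_ : _ @^-1` _ = (f @^-1` K) `*` [set: I]).
  by apply: compact_setX => //; exact: unit_interval_compact.
by apply/seteqP; split => p //= [].
Qed.

Lemma proper_homotopic_sym X Y (f g : X -> Y) :
  proper_homotopic R f g -> proper_homotopic R g f.
Proof.
move=> [H [pH H0 H1]]; exists (reverse H); split; first exact: reverse_proper.
- by move=> x; rewrite reverse_zero.
- by move=> x; rewrite reverse_one.
Qed.

Lemma proper_homotopic_trans X Y (f g h : X -> Y) :
  proper_homotopic R f g -> proper_homotopic R g h -> proper_homotopic R f h.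
Proof.
move=> [H [pH H0 H1]] [K [pK K0 K1]]; exists (concat H K); split.
- by apply: concat_proper => // x; rewrite H1 K0.
- by move=> x; rewrite concat_zero.
- by move=> x; rewrite concat_one.
Qed.

Lemma proper_homotopic_compl X Y Z (f g : X -> Y) (h : Y -> Z) :
  proper_map h -> proper_homotopic R f g ->
  proper_homotopic R (h \o f) (h \o g).
Proof.
move=> ph [H [pH H0 H1]]; exists (h \o H); split; first exact: proper_comp.
- by move=> x; rewrite /= H0.
- by move=> x; rewrite /= H1.
Qed.

(* Compact subsets of Z must be closed for H \o (k x id) to be proper. *)
Lemma proper_homotopic_compr X Y Z (f g : Y -> Z) (k : X -> Y) :
  hausdorff_space Z -> proper_map k -> proper_homotopic R f g ->
  proper_homotopic R (f \o k) (g \o k).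
Proof.
move=> hZ [ck pk] [H [[cH pH] H0 H1]].
pose k1 (p : X * I) := (k p.1, p.2).
have ck1 : continuous k1.
  apply: pair_continuous; last exact: snd_continuous.
  by apply: comp_continuous => //; exact: fst_continuous.
exists (H \o k1); split.
- split=> [|K cK]; first exact: comp_continuous.
  apply: (@subclosed_compact _ _ ((k @^-1` (fst @` (H @^-1` K))) `*` [set: I])).
  + apply: closed_comp; last exact: compact_closed.
    by move=> p _; apply: comp_continuous.
  + apply: compact_setX; last exact: unit_interval_compact.
    by apply: pk; apply: image_compact; [exact: fst_continuous|exact: pH].
  + by move=> p /= Kp; split => //; exists (k1 p).
- by move=> x; rewrite /= -H0.
- by move=> x; rewrite /= -H1.
Qed.

Lemma proper_homotopic_comp X Y Z (f f' : X -> Y) (g g' : Y -> Z) :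
  hausdorff_space Z -> proper_map f -> proper_map g' ->
  proper_homotopic R f f' -> proper_homotopic R g g' ->
  proper_homotopic R (g \o f) (g' \o f').
Proof.
move=> hZ pf pg' ff' gg'; apply: (@proper_homotopic_trans _ _ _ (g' \o f)).
- exact: proper_homotopic_compr.
- exact: proper_homotopic_compl.
Qed.

End proper.

Section path_components.
Context (R : realType) {X : topologicalType}.
Local Notation I := (unit_interval R).

(* empty when x is not in A *)
Definition path_component (A : set X) (x : X) : set X :=
  [set y | exists p : {path I from x to y}, range p `<=` A].

Lemma path_component_sub A x : path_component A x `<=` A.
Proof. by move=> y [p pA]; apply: pA; exists one => //; exact: path_one. Qed.

Lemma path_component_refl A x : A x -> path_component A x x.
Proof.
move=> Ax; exists [the {path I from x to x} of cst x].
by move=> _ [t _ <-]; exact: Ax.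
Qed.

Let slice_continuous (H : X * I -> X) (x : X) :
  continuous H -> continuous (fun t : I => H (x, t)).
Proof.
move=> cH; apply: (@comp_continuous _ _ _ (fun t : I => (x, t)) H) => //.
by apply: pair_continuous; [exact: cst_continuous|move=> t; exact: cvg_id].
Qed.

Let on_snd_continuous (p : I -> X) :
  continuous p -> continuous (p \o snd : X * I -> X).
Proof. by move=> cp; apply: comp_continuous => //; exact: snd_continuous. Qed.

Lemma path_component_sym A x y :
  path_component A x y -> path_component A y x.
Proof.
move=> [p pA]; pose q t := reverse (p \o snd) (x, t).
have cq : continuous q.
  apply: slice_continuous; apply: reverse_continuous.
  exact/on_snd_continuous/cts_fun.
have q0 : q zero = y by rewrite /q reverse_zero/= path_one.
have q1 : q one = x by rewrite /q reverse_one/= path_zero.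
exists (mk_path cq q0 q1) => _ [t _ <-].
by apply: pA; exists (clamp (1 - ival t)).
Qed.

Lemma path_component_trans A x y z :
  path_component A x y -> path_component A y z -> path_component A x z.
Proof.
move=> [p pA] [q qA]; pose r t := concat (p \o snd) (q \o snd) (x, t).
have cr : continuous r.
  apply: slice_continuous; apply: concat_continuous.
  - exact/on_snd_continuous/cts_fun.
  - exact/on_snd_continuous/cts_fun.
  - by move=> u /=; rewrite path_one path_zero.
have r0 : r zero = x by rewrite /r concat_zero/= path_zero.
have r1 : r one = z by rewrite /r concat_one/= path_one.
exists (mk_path cr r0 r1) => _ [t _ <-].
change (A (r t)); rewrite /r /concat.
by case: (_ <= _); [apply: pA|apply: qA]; apply: imageT.
Qed.

Lemma same_path_component A x y :
  path_component A x y -> path_component A x = path_component A y.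
Proof.
move=> xy; apply/seteqP; split => z; last exact: path_component_trans.
by apply: path_component_trans; exact: path_component_sym.
Qed.

(* the elements of pi_0 of the subspace A, as subsets of X *)
Definition pi0 (A : set X) : set (set X) :=
  [set path_component A x | x in A].

Lemma pi0_eq A (C D : set X) : pi0 A C -> pi0 A D -> C `&` D !=set0 -> C = D.
Proof.
move=> [x Ax <-] [y Ay <-] [z [xz yz]].
by rewrite (same_path_component xz) (same_path_component yz).
Qed.

Lemma pi0_nonempty A (C : set X) : pi0 A C -> C !=set0.
Proof. by move=> [x Ax <-]; exists x; exact: path_component_refl. Qed.

End path_components.

Section ends.
Context (R : realType) (X : topologicalType).

Definition compacts : Type := {K : set X | compact K}.

Lemma compacts_union_subproof (K L : compacts) : compact (sval K `|` sval L).
Proof. by apply: compactU; exact: svalP. Qed.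

Definition compacts_union (K L : compacts) : compacts :=
  exist _ _ (@compacts_union_subproof K L).

(* An element of the inverse limit: for K `<=` L, the bonding map sends a
   component of ~` L to the component of ~` K that contains it. *)
Record ends : Type := End {
  end_at : compacts -> set X;
  end_at_pi0 : forall K, pi0 R (~` sval K) (end_at K);
  end_at_sub : forall K L, sval K `<=` sval L -> end_at L `<=` end_at K
}.

HB.instance Definition _ := gen_eqMixin ends.
HB.instance Definition _ := gen_choiceMixin ends.

Definition freudenthal : Type := (X + ends)%type.

HB.instance Definition _ := Choice.on freudenthal.

Definition of_point (x : X) : freudenthal := inl x.
Definition of_end (e : ends) : freudenthal := inr e.

(* The trace on X is open, and around each end e the set contains, for some
   compact K, the component e(K) together with all the ends lying in it. *)
Definition freudenthal_open : set_system freudenthal := fun U =>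
  open (of_point @^-1` U) /\
  forall e, U (of_end e) -> exists K : compacts,
    end_at e K `<=` of_point @^-1` U /\
    forall e', end_at e' K = end_at e K -> U (of_end e').

Lemma end_at_sub_eq (e e' : ends) (K L : compacts) : sval K `<=` sval L ->
  end_at e' L = end_at e L -> end_at e' K = end_at e K.
Proof.
move=> KL ee'; apply: pi0_eq; [exact: end_at_pi0|exact: end_at_pi0|].
have [x ex] := pi0_nonempty (end_at_pi0 e L).
by exists x; split; apply: end_at_sub KL _ _; rewrite ?ee'.
Qed.

Lemma freudenthal_openT : freudenthal_open setT.
Proof.
split; first by rewrite preimage_setT; exact: openT.
by move=> e _; exists (exist _ set0 (@compact0 X)).
Qed.

Lemma freudenthal_openI : setI_closed freudenthal_open.
Proof.
move=> U V [oU eU] [oV eV]; split; first by rewrite preimage_setI; exact: openI.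
move=> e [/eU[K [KU KU']] /eV[L [LV LV']]]; exists (compacts_union K L).
have sK : sval K `<=` sval (compacts_union K L) by left.
have sL : sval L `<=` sval (compacts_union K L) by right.
split=> [x ex|e' ee'].
- by split; [apply: KU; exact: end_at_sub sK _ ex
            |apply: LV; exact: end_at_sub sL _ ex].
- by split; [apply: KU'; exact: end_at_sub_eq sK ee'
            |apply: LV'; exact: end_at_sub_eq sL ee'].
Qed.

Lemma freudenthal_open_bigU (J : Type) (U : J -> set freudenthal) :
  (forall j, freudenthal_open (U j)) -> freudenthal_open (\bigcup_j U j).
Proof.
move=> oU; split.
  by rewrite preimage_bigcup; apply: bigcup_open => j _; have [] := oU j.
move=> e [j _ Uje]; have [_ /(_ _ Uje)[K [KU KU']]] := oU j.
exists K; split => [x /KU Ux|e' /KU' Ue']; first by exists j.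
by exists j.
Qed.

HB.instance Definition _ := isOpenTopological.Build freudenthal
  freudenthal_openT freudenthal_openI freudenthal_open_bigU.

End ends.

HB.mixin Record isHausdorff T of Topological T := {
  hausdorffP : hausdorff_space T
}.

#[short(type="hausdorffType")]
HB.structure Definition Hausdorff := {T of Topological T & isHausdorff T}.

Record phe (R : realType) (X : topologicalType) : Type := Phe {
  phe_fun :> X -> X;
  pheP : proper_homotopy_equivalence R phe_fun
}.

HB.instance Definition _ (R : realType) (X : topologicalType) :=
  gen_eqMixin (phe R X).
HB.instance Definition _ (R : realType) (X : topologicalType) :=
  gen_choiceMixin (phe R X).

Section maps.
Context (R : realType) (X : topologicalType).
Implicit Types f g : phe R X.

Lemma phe_proper f : proper_map f.
Proof. by have [g []] := pheP f. Qed.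

Definition phe_rel f g : bool := `[< proper_homotopic R f g >].

Lemma phe_rel_refl : reflexive phe_rel.
Proof. by move=> f; apply/asboolP/proper_homotopic_refl/phe_proper. Qed.

Lemma phe_rel_sym : symmetric phe_rel.
Proof.
by move=> f g; apply/asboolP/asboolP; exact: proper_homotopic_sym.
Qed.

Lemma phe_rel_trans : transitive phe_rel.
Proof.
move=> g f h /asboolP fg /asboolP gh; apply/asboolP.
exact: proper_homotopic_trans fg gh.
Qed.

Canonical phe_equiv := EquivRel phe_rel phe_rel_refl phe_rel_sym phe_rel_trans.

Definition Maps : Type := {eq_quot phe_equiv}.

HB.instance Definition _ := Choice.on Maps.
HB.instance Definition _ := Quotient.on Maps.

Definition mclass f : Maps := \pi_Maps f.

Lemma mclassP f g : mclass f = mclass g <-> proper_homotopic R f g.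
Proof.
by split => [/eqmodP/asboolP//|fg]; apply/eqmodP; exact/asboolP.
Qed.

Lemma mclassK (a : Maps) : mclass (repr a) = a.
Proof. exact: reprK. Qed.

Local Notation E := (freudenthal R X).

Definition extends (F : E -> E) (f : X -> X) : Prop :=
  continuous F /\ forall x, F (of_point R x) = of_point R (f x).

Definition PH_set : set ({compact-open, E -> E} * {compact-open, E -> E}) :=
  [set FG | exists f g : X -> X,
    [/\ proper_homotopy_inverse R f g, extends FG.1 f & extends FG.2 g]].

(* the coercion of a set to a type, which carries the subspace topology *)
Definition PH : Type := PH_set.

HB.instance Definition _ := Topological.copy PH (PH_set : Type).

Lemma PH_ex (p : PH) : exists f : phe R X, extends (sval p).1 f.
Proof.
have [f [g [fg Ff _]]] := set_mem (svalP p).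
by exists (@Phe R X f (ex_intro _ g fg)).
Qed.

Definition PH_class (p : PH) : Maps := mclass (sval (cid (PH_ex p))).

Lemma PH_classE (p : PH) (f : phe R X) :
  extends (sval p).1 f -> PH_class p = mclass f.
Proof.
move=> [_ Ff]; rewrite /PH_class; case: cid => f' [_ Ff'] /=; apply/mclassP.
have -> : phe_fun f' = phe_fun f.
  by apply/funext => x; have := Ff x; rewrite Ff' => -[].
exact/proper_homotopic_refl/phe_proper.
Qed.

(* the quotient topology along PH_class, the map (F, G) |-> [f] of PH_classE *)
Definition Maps_open : set_system Maps := fun U => open (PH_class @^-1` U).

Lemma Maps_openT : Maps_open setT.
Proof. by rewrite /Maps_open preimage_setT; exact: openT. Qed.

Lemma Maps_openI : setI_closed Maps_open.
Proof. by move=> U V oU oV; rewrite /Maps_open preimage_setI; exact: openI. Qed.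

Lemma Maps_open_bigU (J : Type) (U : J -> set Maps) :
  (forall j, Maps_open (U j)) -> Maps_open (\bigcup_j U j).
Proof.
by move=> oU; rewrite /Maps_open preimage_bigcup; apply: bigcup_open => j _; exact: oU.
Qed.

HB.instance Definition _ := isOpenTopological.Build Maps
  Maps_openT Maps_openI Maps_open_bigU.

End maps.

Section maps_group.
Context (R : realType) (X : hausdorffType).
Implicit Types f g : phe R X.
Local Notation M := (Maps R X).

Lemma phe_id_subproof : proper_homotopy_equivalence R (@id X).
Proof.
exists id; split; do ?exact: proper_id.
- exact/proper_homotopic_refl/proper_id.
- exact/proper_homotopic_refl/proper_id.
Qed.

Definition phe_id : phe R X := Phe phe_id_subproof.

Lemma phe_comp_subproof f g : proper_homotopy_equivalence R (f \o g).
Proof.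
have [f' [pf pf' ff' f'f]] := pheP f; have [g' [pg pg' gg' g'g]] := pheP g.
exists (g' \o f'); split; do ?exact: proper_comp.
- apply: (proper_homotopic_trans _ ff').
  have := proper_homotopic_compl pf (proper_homotopic_compr hausdorffP pf' gg').
  exact.
- apply: (proper_homotopic_trans _ g'g).
  have := proper_homotopic_compl pg' (proper_homotopic_compr hausdorffP pg f'f).
  exact.
Qed.

Definition phe_comp f g : phe R X := Phe (phe_comp_subproof f g).

Lemma phe_inv_subproof f :
  proper_homotopy_equivalence R (sval (cid (pheP f))).
Proof. by case: cid => g /= [pf pg fg gf]; exists f. Qed.

Definition phe_inv f : phe R X := Phe (phe_inv_subproof f).

Definition Maps_one : M := mclass phe_id.
Definition Maps_mul (a b : M) : M := mclass (phe_comp (repr a) (repr b)).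
Definition Maps_inv (a : M) : M := mclass (phe_inv (repr a)).

Lemma mclass_mul f g : Maps_mul (mclass f) (mclass g) = mclass (phe_comp f g).
Proof.
apply/mclassP; apply: proper_homotopic_comp; [exact: hausdorffP|
  exact: phe_proper|exact: phe_proper|..]; apply/mclassP; exact: mclassK.
Qed.

Lemma Maps_mulA : associative Maps_mul.
Proof.
move=> a b c; rewrite -(mclassK a) -(mclassK b) -(mclassK c) !mclass_mul.
exact/mclassP/proper_homotopic_refl/(phe_proper (phe_comp _ (phe_comp _ _))).
Qed.

Lemma Maps_mul1 : left_id Maps_one Maps_mul.
Proof.
move=> a; rewrite -(mclassK a) mclass_mul.
exact/mclassP/proper_homotopic_refl/phe_proper.
Qed.

Lemma Maps_mulr1 : right_id Maps_one Maps_mul.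
Proof.
move=> a; rewrite -(mclassK a) mclass_mul.
exact/mclassP/proper_homotopic_refl/phe_proper.
Qed.

Lemma Maps_mulV : left_inverse Maps_one Maps_inv Maps_mul.
Proof.
move=> a; rewrite -{2}(mclassK a) mclass_mul; apply/mclassP => /=.
by case: cid => g [].
Qed.

Lemma Maps_mulrV : right_inverse Maps_one Maps_inv Maps_mul.
Proof.
move=> a; rewrite -{1}(mclassK a) mclass_mul; apply/mclassP => /=.
by case: cid => g [].
Qed.

HB.instance Definition _ := isGroup.Build M
  Maps_mulA Maps_mul1 Maps_mulr1 Maps_mulV Maps_mulrV.

Lemma mclassM f g : (mclass f * mclass g)%g = mclass (phe_comp f g).
Proof. exact: mclass_mul. Qed.

End maps_group.

(* Multigraphs, loops allowed. The orientation of the edges only serves to name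
   the two ends of each edge; as a space, a graph is the 1-dimensional CW
   complex [realization] below. *)
Record graph : Type := Graph {
  vertex : choiceType;
  edge : choiceType;
  source : edge -> vertex;
  target : edge -> vertex
}.

Definition locally_finite (G : graph) : Prop :=
  forall v : vertex G,
    finite_set [set e : edge G | source e = v \/ target e = v].

Section realization.
Context (R : realType) (G : graph).
Local Notation I := (unit_interval R).

Definition closed_cell (c : vertex G + edge G) : topologicalType :=
  match c with inl _ => discrete_topology unit | inr _ => I end.

(* the disjoint union of the vertices and of one copy of [0, 1] per edge *)
Definition cells : Type := {c : vertex G + edge G & closed_cell c}.
HB.instance Definition _ := Topological.on cells.

Definition vertex_cell (v : vertex G) : cells := existT closed_cell (inl v) tt.
Definition edge_cell (e : edge G) (t : I) : cells := existT closed_cell (inr e) t.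

(* A normal form for points of cells modulo the gluing of the endpoints of the
   edges: two points are identified iff they have the same image by attach. *)
Definition attach (z : cells) : cells :=
  match z with
  | existT (inl v) _ => vertex_cell v
  | existT (inr e) t =>
      if t == zero then vertex_cell (source e)
      else if t == one then vertex_cell (target e)
      else edge_cell e t
  end.

Definition attach_rel (z w : cells) : bool := attach z == attach w.

Lemma attach_rel_refl : reflexive attach_rel. Proof. by move=> z; exact: eqxx. Qed.
Lemma attach_rel_sym : symmetric attach_rel.
Proof. by move=> z w; exact: eq_sym. Qed.
Lemma attach_rel_trans : transitive attach_rel.
Proof. by move=> w z u /eqP zw /eqP wu; rewrite /attach_rel zw wu. Qed.

Canonical attach_equiv :=
  EquivRel attach_rel attach_rel_refl attach_rel_sym attach_rel_trans.

Definition realization : Type := {eq_quot attach_equiv}.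
HB.instance Definition _ := Topological.copy realization
  (quotient_topology realization).
HB.instance Definition _ := Quotient.on realization.

Definition of_cells (z : cells) : realization := \pi_realization z.

Lemma of_cellsP (z w : cells) :
  of_cells z = of_cells w <-> attach z = attach w.
Proof.
by split=> [/eqmodP/eqP//|zw]; apply/eqmodP/eqP.
Qed.

Definition lift_cells (h : cells -> R) : realization -> R := h \o repr.

Lemma lift_cells_continuous (h : cells -> R) : continuous h ->
  (forall z, h (attach z) = h z) -> continuous (lift_cells h).
Proof.
move=> ch hE; apply: repr_comp_continuous => // z w /eqP/eqmodP/eqP zw.
by rewrite -(hE z) -(hE w) zw.
Qed.

Lemma lift_cellsE (h : cells -> R) : (forall z, h (attach z) = h z) ->
  forall z, lift_cells h (of_cells z) = h z.
Proof.
move=> hE z; rewrite /lift_cells /= -hE -[RHS]hE; congr h.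
by apply/of_cellsP; exact: reprK.
Qed.

Lemma attachK (z : cells) : attach (attach z) = attach z.
Proof.
case: z => [[v|e] t] //=; case: ifPn => //= t0; case: ifPn => //= t1.
by rewrite (negbTE t0) (negbTE t1).
Qed.

Definition cell_fun (a : vertex G -> R) (b : edge G -> R -> R) (z : cells) : R :=
  match z with
  | existT (inl v) _ => a v
  | existT (inr e) t => b e (ival (t : I))
  end.

Lemma cell_fun_continuous a b :
  (forall e, continuous (b e)) -> continuous (cell_fun a b).
Proof.
move=> cb; pose f c : closed_cell c -> R :=
  match c return closed_cell c -> R with
  | inl v => fun=> a v | inr e => fun t => b e (ival (t : I)) end.
have cf c : continuous (f c).
  case: c => [v|e]; first exact: cst_continuous.
  exact: (@comp_continuous _ _ _ (@ival R) (b e) (@ival_continuous R) (cb e)).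
have -> : cell_fun a b = unstable.sigT_fun f by apply/funext => -[[v|e] t].
exact: (@sigT_continuous _ closed_cell R f cf).
Qed.

Lemma cell_fun_attach a b :
  (forall e, b e 0 = a (source e)) -> (forall e, b e 1 = a (target e)) ->
  forall z, cell_fun a b (attach z) = cell_fun a b z.
Proof.
move=> b0 b1 [[v|e] t] //=.
case: eqP => [->|_] /=; first by rewrite ival_zero b0.
by case: eqP => [->|_] //=; rewrite ival_one b1.
Qed.

Lemma cluster_fun (X : topologicalType) (h : X -> R) (p q : X) :
  continuous h -> cluster (nbhs p) q -> h p = h q.
Proof.
move=> ch pq; apply: (@Rhausdorff R) => U V hpU hqV.
have [x [Ux Vx]] := pq _ _ (ch p _ hpU) (ch q _ hqV).
by exists (h x).
Qed.

Lemma realization_hausdorff : hausdorff_space realization.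
Proof.
move=> p q pq; rewrite -(reprK p) -(reprK q); apply/of_cellsP.
set z := attach (repr p); set w := attach (repr q).
have E (a : vertex G -> R) (b : edge G -> R -> R) : (forall e, continuous (b e)) ->
    (forall e, b e 0 = a (source e)) -> (forall e, b e 1 = a (target e)) ->
    cell_fun a b z = cell_fun a b w.
  move=> cb b0 b1; have ab := cell_fun_attach b0 b1.
  rewrite /z /w !ab -!(lift_cellsE ab) /of_cells !reprK.
  by apply: cluster_fun => //; exact/lift_cells_continuous/ab/cell_fun_continuous.
have idz : attach z = z by exact: attachK.
have idw : attach w = w by exact: attachK.
have Ev v : cell_fun (fun u => (u == v)%:R)
      (fun e x => (source e == v)%:R * (1 - x) + (target e == v)%:R * x) z =
    cell_fun (fun u => (u == v)%:R)
      (fun e x => (source e == v)%:R * (1 - x) + (target e == v)%:R * x) w.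
  apply: E => e; rewrite ?subr0 ?subrr ?mulr0 ?mulr1 ?addr0 ?add0r// => x.
  apply: cvgD; apply: cvgM; [exact: cvg_cst| |exact: cvg_cst|exact: cvg_id].
  by apply: cvgB; [exact: cvg_cst|exact: cvg_id].
have Ee (k : R -> R) e : continuous k -> k 0 = 0 -> k 1 = 0 ->
    cell_fun (fun=> 0) (fun e' x => (e' == e)%:R * k x) z =
    cell_fun (fun=> 0) (fun e' x => (e' == e)%:R * k x) w.
  move=> ck k0 k1; apply: E => e'; rewrite ?k0 ?k1 ?mulr0// => x.
  by apply: cvgM; [exact: cvg_cst|exact: ck].
pose k1 x : R := x * (1 - x); pose k2 x : R := x * k1 x.
have ck1 : continuous k1.
  move=> x; apply: cvgM; first exact: cvg_id.
  by apply: cvgB; [exact: cvg_cst|exact: cvg_id].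
have ck2 : continuous k2 by move=> x; apply: cvgM; [exact: cvg_id|exact: ck1].
have {Ee} [E1 E2] : 
    (forall e, cell_fun (fun=> 0) (fun e' x => (e' == e)%:R * k1 x) z =
      cell_fun (fun=> 0) (fun e' x => (e' == e)%:R * k1 x) w) /\
    (forall e, cell_fun (fun=> 0) (fun e' x => (e' == e)%:R * k2 x) z =
      cell_fun (fun=> 0) (fun e' x => (e' == e)%:R * k2 x) w).
  by split=> e; apply: Ee => //; rewrite /k2 /k1; ring.
have interior e (t : I) : attach (edge_cell e t) = edge_cell e t ->
    0 < k1 (ival t).
  rewrite /attach /edge_cell; case: eqP => [_ /(congr1 tag)//|/eqP t0].
  case: eqP => [_ /(congr1 tag)//|/eqP t1 _].
  rewrite /k1 mulr_gt0// ?subr_gt0 lt_neqAle ?ival_ge0 ?ival_le1 andbT.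
  - by apply: contra t0 => /eqP t0; apply/eqP/ival_inj; rewrite ival_zero.
  - by apply: contra t1 => /eqP t1; apply/eqP/ival_inj; rewrite ival_one.
move: idz idw Ev E1 E2; clearbody z w; clear E pq.
case: z => [[u|e] t]; case: w => [[v|e'] t'] //= idz idw Ev E1 E2.
- have /eqP := Ev u; rewrite eqxx.
  case: (v =P u) => [->|_]; last by rewrite oner_eq0.
  by case: t {idz}; case: t' {idw}.
- have := E1 e'; rewrite eqxx /= ?mulr1n mul1r => /eqP; rewrite lt_eqF//.
  exact: interior idw.
- have := E1 e; rewrite eqxx /= ?mulr1n mul1r => /eqP; rewrite gt_eqF//.
  exact: interior idz.
- have k1t := interior _ _ idz; have k1t' := interior _ _ idw.
  have := E1 e; rewrite eqxx /= ?mulr1n mul1r; case: (e' =P e) => [ee|_]; last first.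
    by rewrite mul0r => /eqP; rewrite gt_eqF.
  rewrite mul1r => k1tt'; move: (E2 e); rewrite ee eqxx /= ?mulr1n !mul1r /k2 k1tt'.
  move=> /(mulIf (lt0r_neq0 k1t')) tt'.
  by subst e'; congr existT; exact: ival_inj.
Qed.

HB.instance Definition _ := isHausdorff.Build realization realization_hausdorff.

End realization.

(* Main.v *)
Require Import Defs.
From HB Require Import structures.
From mathcomp Require Import all_boot all_order all_algebra.
From mathcomp Require Import all_classical all_reals.
From mathcomp Require Import topology normedtype homotopy.

Local Open Scope classical_set_scope.

(** If [h : X -> Y] and [k : Y -> X] are proper homotopy inverses, the
    isomorphism is conjugation, [f] |-> [h f k]. It is continuous because every
    proper map extends to the end compactifications, so that it lifts to
    (F, G) |-> (h^ F k^, h^ G k^) from PH X to PH Y, and pre- and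
    post-composition by fixed continuous maps are continuous for the
    compact-open topology. *)

Set Implicit Arguments.
Unset Strict Implicit.

Section path_component_image.
Context (R : realType).

Lemma path_component_subset (X : topologicalType) (A B : set X) (x : X) :
  A `<=` B -> path_component R A x `<=` path_component R B x.
Proof. by move=> AB y [p pA]; exists p => z /pA/AB. Qed.

Lemma path_component_image (X Y : topologicalType) (f : X -> Y) (A : set X)
    (B : set Y) (x y : X) : continuous f -> f @` A `<=` B ->
  path_component R A x y -> path_component R B (f x) (f y).
Proof.
move=> cf fAB [p pA].
have cfp : continuous (f \o p).
  by apply: comp_continuous => //; exact: cts_fun.
have fp0 : (f \o p) zero = f x by rewrite /= path_zero.
have fp1 : (f \o p) one = f y by rewrite /= path_one.
exists (mk_path cfp fp0 fp1) => _ [t _ <-].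
by apply: fAB; exists (p t) => //; apply: pA; exists t.
Qed.

End path_component_image.

Section freudenthal_extension.
Context (R : realType) (X Y : topologicalType) (f : X -> Y).
Hypothesis pf : proper_map f.

Definition compacts_preimage (L : compacts Y) : compacts X :=
  exist _ (f @^-1` sval L) (proj2 pf (sval L) (svalP L)).

(* All the path components in this union are equal. *)
Definition end_image_at (e : ends R X) (L : compacts Y) : set Y :=
  \bigcup_(x in end_at e (compacts_preimage L)) path_component R (~` sval L) (f x).

(** [f] maps the complement of the preimage of [L] into the complement of [L], so paths between
    points of the given component are carried to paths avoiding [L]. *)
Lemma end_image_at_pi0 e L : pi0 R (~` sval L) (end_image_at e L).
Proof.
have := end_at_pi0 e (compacts_preimage L); rewrite /end_image_at => -[x xL <-].
exists (f x) => //; apply/seteqP; split => [y xy|y [z xz]].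
  by exists x => //; exact: path_component_refl.
apply: path_component_trans.
by apply: path_component_image xz => [|_ [w wL <-] //]; case: pf.
Qed.

Lemma end_image_at_sub e (K L : compacts Y) : sval K `<=` sval L ->
  end_image_at e L `<=` end_image_at e K.
Proof.
move=> KL y [x xL xy]; exists x.
  by apply: end_at_sub xL => z; exact: KL.
by apply: path_component_subset xy; exact: subsetC.
Qed.

Definition end_image (e : ends R X) : ends R Y :=
  End (end_image_at_pi0 e) (@end_image_at_sub e).

Definition freudenthal_map (p : freudenthal R X) : freudenthal R Y :=
  match p with
  | inl x => of_point R (f x)
  | inr e => of_end (end_image e)
  end.

(** If [L] witnesses openness at the image of an end [e], then its compact preimage under [f]
    witnesses it at [e]. *)
Lemma freudenthal_map_continuous : continuous freudenthal_map.
Proof.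
apply/continuousP => U [oU eU]; split.
  by apply: (open_comp (f := f) _ oU) => x _; case: pf => + _; exact.
move=> e /eU [L [LU LU']]; exists (compacts_preimage L); split => [x ex|e' ee'].
  (* The constant path at [f x] suffices once [x] is known to lie outside the preimage of [L]. *)
  apply: LU; exists x => //; apply: path_component_refl.
  have := end_at_pi0 e (compacts_preimage L); case=> z _ zE.
  by move: ex; rewrite -zE => /path_component_sub.
(* The image of an end at [L] depends only on that end at the preimage of [L]. *)
by apply: LU'; rewrite /= /end_image_at ee'.
Qed.

End freudenthal_extension.

Lemma compact_open_conj_continuous (S T U V : topologicalType) (h : T -> V)
    (k : S -> U) : continuous h -> continuous k ->
  continuous ((fun F => h \o F \o k) :
    {compact-open, U -> T} -> {compact-open, S -> V}).
Proof.
move=> ch ck F; apply/compact_open_cvgP.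
  by apply: fmap_filter; exact: nbhs_filter.
move=> K O cK oO FKO.
(* [h \o F' \o k] sends [K] into [O] iff [F'] sends the compact set [k @] K[into the open set]h
   @^-1[O]. *)
pose A := [set F' : {compact-open, U -> T} | F' @` (k @` K) `<=` h @^-1` O].
have oA : open A.
  apply: compact_open_open; first exact: image_compact.
  by apply: (open_comp (f := h) _ oO) => x _; exact: ch.
have AF : A F by move=> _ [_ [s Ks <-] <-]; apply: FKO; exists s.
apply: filterS (open_nbhs_nbhs (conj oA AF)) => F' F'KO _ [s Ks <-].
by apply: F'KO; exists (k s) => //; exists s.
Qed.

(** Serves to cancel [k \o h] or a similar factor inside a composite. Precomposition by [g] takes
    place among maps into [Y], so only [Y] has to be Hausdorff. *)
Lemma proper_homotopic_mid (R : realType) (X Y Z : topologicalType)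
    (f : Y -> Z) (u : Y -> Y) (g : X -> Y) : hausdorff_space Y ->
  proper_map f -> proper_map g ->
  proper_homotopic R u id -> proper_homotopic R (f \o u \o g) (f \o g).
Proof.
move=> hY pf pg uid.
exact: (proper_homotopic_compl pf (proper_homotopic_compr hY pg uid)).
Qed.

Section conjugation.
Context (R : realType) (X Y : hausdorffType) (h : X -> Y) (k : Y -> X).
Hypothesis hk : proper_homotopy_inverse R h k.

Let ph : proper_map h. Proof. by case: hk. Qed.
Let pk : proper_map k. Proof. by case: hk. Qed.

Lemma proper_homotopy_inverse_conj (f g : X -> X) :
  proper_homotopy_inverse R f g ->
  proper_homotopy_inverse R (h \o f \o k) (h \o g \o k).
Proof.
move=> [pf pg fg gf]; have [_ _ hkid khid] := hk.
(* The chain is h a (k h) b k ~ h (a b) k ~ h k ~ id. *)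
have conj_id (a b : X -> X) : proper_map a -> proper_map b ->
    proper_homotopic R (a \o b) id ->
    proper_homotopic R ((h \o a \o k) \o (h \o b \o k)) id.
  move=> pa pb ab; apply: (proper_homotopic_trans _ hkid).
  apply: (@proper_homotopic_trans _ _ _ _ (h \o (a \o b) \o k)); last first.
    by apply: proper_homotopic_mid => //; exact: hausdorffP.
  apply: (@proper_homotopic_mid _ _ _ _ (h \o a) (k \o h) (b \o k)) => //;
    by [exact: hausdorffP|exact: proper_comp].
split; [| |exact: conj_id|exact: conj_id];
  by apply: proper_comp => //; exact: proper_comp.
Qed.

Lemma phe_conj_subproof (f : phe R X) :
  proper_homotopy_equivalence R (h \o f \o k).
Proof.
have [g fg] := pheP f; exists (h \o g \o k).
exact: proper_homotopy_inverse_conj.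
Qed.

Definition phe_conj (f : phe R X) : phe R Y := Phe (phe_conj_subproof f).

Definition Maps_conj (a : Maps R X) : Maps R Y := mclass (phe_conj (repr a)).

(** Conjugation preserves proper homotopy, so the choice made by [repr] does not matter. *)
Lemma Maps_conjE (f : phe R X) : Maps_conj (mclass f) = mclass (phe_conj f).
Proof.
apply/mclassP.
apply: (@proper_homotopic_compr _ _ _ _ (h \o _) (h \o _)) => //.
  exact: hausdorffP.
by apply: proper_homotopic_compl => //; apply/mclassP; exact: mclassK.
Qed.

Lemma Maps_conjM (a b : Maps R X) :
  Maps_conj (a * b)%g = (Maps_conj a * Maps_conj b)%g.
Proof.
have [_ _ _ khid] := hk.
rewrite -(mclassK a) -(mclassK b) mclassM !Maps_conjE mclassM.
apply/mclassP/proper_homotopic_sym.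
(* The inner factor of (h a k)(h b k) is k h, which is homotopic to the identity. *)
apply: (@proper_homotopic_mid _ _ _ _ (h \o repr a) (k \o h) (repr b \o k)) => //.
- exact: hausdorffP.
- by apply: proper_comp => //; exact: phe_proper.
- by apply: proper_comp => //; exact: phe_proper.
Qed.

Definition freudenthal_conj (F : {compact-open, freudenthal R X -> freudenthal R X}) :
    {compact-open, freudenthal R Y -> freudenthal R Y} :=
  freudenthal_map ph \o F \o freudenthal_map pk.

Lemma freudenthal_conj_continuous : continuous freudenthal_conj.
Proof.
by apply: compact_open_conj_continuous; exact: freudenthal_map_continuous.
Qed.

Lemma extends_conj (F : freudenthal R X -> freudenthal R X) (f : X -> X) :
  extends F f -> extends (freudenthal_conj F) (h \o f \o k).
Proof.
move=> [cF Ff]; split=> [|y].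
  apply: comp_continuous; first exact: freudenthal_map_continuous.
  by apply: comp_continuous => //; exact: freudenthal_map_continuous.
by rewrite /freudenthal_conj /= -/(of_point R _) Ff.
Qed.

Lemma PH_conj_subproof (p : PH R X) :
  (freudenthal_conj (sval p).1, freudenthal_conj (sval p).2) \in @PH_set R Y.
Proof.
have [f [g [fg Ff Gg]]] := set_mem (svalP p); apply/mem_set.
exists (h \o f \o k), (h \o g \o k).
by split; [exact: proper_homotopy_inverse_conj|exact: extends_conj..].
Qed.

Definition PH_conj (p : PH R X) : PH R Y :=
  exist (fun FG => FG \in @PH_set R Y) _ (PH_conj_subproof p).

Lemma PH_conj_continuous : continuous PH_conj.
Proof.
apply: continuous_comp_initial.
have cval : continuous (fun p : PH R X => sval p) by exact: initial_continuous.
have c1 : continuous (fun p : PH R X => (sval p).1).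
  exact: comp_continuous cval (@fst_continuous _ _).
have c2 : continuous (fun p : PH R X => (sval p).2).
  exact: comp_continuous cval (@snd_continuous _ _).
apply: pair_continuous.
- exact: comp_continuous c1 freudenthal_conj_continuous.
- exact: comp_continuous c2 freudenthal_conj_continuous.
Qed.

(** The commuting square that lets continuity descend from [PH_conj] to the quotients. *)
Lemma PH_class_conj (p : PH R X) : PH_class (PH_conj p) = Maps_conj (PH_class p).
Proof.
have [f Ff] := PH_ex p; rewrite (PH_classE Ff) Maps_conjE.
by apply: PH_classE; exact: extends_conj.
Qed.

Lemma Maps_conj_continuous : continuous Maps_conj.
Proof.
apply/continuousP => U oU.
(* In the quotient topology, openness is tested on the pullback to [PH]. *)
change (open (@PH_class R X @^-1` (Maps_conj @^-1` U))).
rewrite (_ : _ @^-1` _ = PH_conj @^-1` (@PH_class R Y @^-1` U)).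
  by move/continuousP: PH_conj_continuous; apply.
by apply/seteqP; split => p; rewrite /preimage /= PH_class_conj.
Qed.

End conjugation.

Lemma proper_homotopy_inverse_sym (R : realType) (X Y : topologicalType)
    (h : X -> Y) (k : Y -> X) :
  proper_homotopy_inverse R h k -> proper_homotopy_inverse R k h.
Proof. by move=> []. Qed.

Lemma Maps_conjK (R : realType) (X Y : hausdorffType) (h : X -> Y) (k : Y -> X)
    (hk : proper_homotopy_inverse R h k) (kh : proper_homotopy_inverse R k h) :
  cancel (Maps_conj hk) (Maps_conj kh).
Proof.
have [ph pk _ khid] := hk; move=> a; rewrite -(mclassK a) !Maps_conjE.
have pa := phe_proper (repr a); apply/mclassP.
(* In (k h) a (k h), the left factor is cancelled first, then the right one. *)
apply: (@proper_homotopic_trans _ _ _ _ (repr a \o (k \o h))).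
  apply: (@proper_homotopic_mid _ _ _ _ id (k \o h) (repr a \o (k \o h))).
  - exact: hausdorffP.
  - exact: proper_id.
  - by apply: proper_comp => //; exact: proper_comp.
  - exact: khid.
exact: (proper_homotopic_compl pa khid).
Qed.

Theorem corollary4p5 (R : realType) (G H : graph)
    (lfG : locally_finite G) (lfH : locally_finite H)
    (connG : connected [set: realization R G])
    (connH : connected [set: realization R H])
    (GH : proper_homotopy_equivalent R (realization R G) (realization R H)) :
  exists (phi : Maps R (realization R G) -> Maps R (realization R H))
         (psi : Maps R (realization R H) -> Maps R (realization R G)),
    [/\ cancel phi psi, cancel psi phi,
        (forall a b, phi (a * b)%g = (phi a * phi b)%g),
        continuous phi & continuous psi].
Proof.
have [h [k hk]] := GH; have kh := proper_homotopy_inverse_sym hk.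
(* The inverse is conjugation by the swapped pair. The Hausdorff property of graph realizations
   makes both conjugations available. *)
exists (Maps_conj hk), (Maps_conj kh); split.
- exact: Maps_conjK.
- exact: Maps_conjK.
- exact: Maps_conjM.
- exact: Maps_conj_continuous.
- exact: Maps_conj_continuous.
Qed.
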